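(* Let $p\ge 1$, let $X\subset\mathbb{R}$ be compact and let $\mathcal U$ be a set of nondecreasing utility functions $u:\mathbb{R}\to\mathbb{R}$. Assume: (a) there exists a constant $L>0$ such that for all $x\in X$, $u\in\mathcal U$ and $\xi,\xi'\in\mathbb{R}$, $$|u(\xi-x)-u(\xi'-x)|\le L\max\{1,|\xi|,|\xi'|\}^{p-1}|\xi-\xi'|;$$ (b) $\mathcal U$ is such that $\psi(t):=\sup_{u\in\mathcal U}|u(t)|$ is a gauge function, that is, $\psi:\mathbb{R}\to[0,\infty)$ is continuous and $\psi\ge 1$ holds outside a compact set. Then there is a constant $C_0>1$ such that, with $\phi(\xi):=C_0+L(|\xi|+|\xi|^p)$, for every $N\in\mathbb{N}$, $$\mathsf{d}_K\big(P^{\otimes N}\circ\hat R_N^{-1},\,Q^{\otimes N}\circ\hat R_N^{-1}\big)\le L\,\mathsf{d}_{FM,p}(P,Q)\qquad\text{for all }P,Q\in\mathcal M^{\phi}.$$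
   Context: $\mathscr P(\mathbb{R})$ is the set of Borel probability measures on $\mathbb{R}$, and $\mathcal M^{\phi}:=\{P\in\mathscr P(\mathbb{R}):\mathbb{E}_P[\phi(\xi)]<\infty\}$. For $P\in\mathscr P(\mathbb{R})$, $R(P):=\max_{x\in X}\inf_{u\in\mathcal U}\mathbb{E}_P[u(x)+u(\xi-x)]$, where $\xi$ has distribution $P$. The estimator $\hat R_N:\mathbb{R}^{N}\to\mathbb{R}$ maps a sample $(\xi^1,\dots,\xi^N)$ to the value of $R$ at the empirical distribution $\frac1N\sum_{i=1}^N\delta_{\xi^i}$, i.e. $$\hat R_N(\xi^1,\dots,\xi^N)=\max_{x\in X}\inf_{u\in\mathcal U}\frac1N\sum_{k=1}^N[u(x)+u(\xi^k-x)].$$ $P^{\otimes N}$ denotes the product measure on $\mathbb{R}^{N}$ with every marginal equal to $P$ (similarly $Q^{\otimes N}$), and $P^{\otimes N}\circ\hat R_N^{-1}$ is the push-forward of $P^{\otimes N}$ under $\hat R_N$, a probability measure on $\mathbb{R}$. For $p\ge1$, the $p$-th order Fortet–Mourier metric is $$\mathsf d_{FM,p}(P,Q):=\sup_{g\in\mathscr G_p(\mathbb{R})}\left|\int_{\mathbb{R}}g\,dP-\int_{\mathbb{R}}g\,dQ\right|,$$ where $\mathscr G_p(\mathbb{R})$ is the set of $g:\mathbb{R}\to\mathbb{R}$ with $|g(\xi)-g(\tilde\xi)|\le\max\{1,|\xi|,|\tilde\xi|\}^{p-1}|\xi-\tilde\xi|$ for all $\xi,\tilde\xi\in\mathbb{R}$.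 The Kantorovich metric is $\mathsf d_K:=\mathsf d_{FM,1}$ (supremum over all functions that are Lipschitz with modulus $1$). *)

(* Defs.v *)
From HB Require Import structures.
From mathcomp Require Import all_boot all_order all_algebra.
From mathcomp Require Import all_classical all_reals all_analysis.

Set Implicit Arguments.
Unset Strict Implicit.
Unset Printing Implicit Defensive.
Import Order.TTheory GRing.Theory Num.Theory.
Import numFieldNormedType.Exports.

Local Open Scope classical_set_scope.
Local Open Scope ring_scope.
Local Open Scope ereal_scope.

Section product_power.
Context d (T : measurableType d) (R : realType).

Definition consT n (z : T * n.-tuple T) : n.+1.-tuple T :=
  [the n.+1.-tuple T of z.1 :: z.2].

Lemma measurable_consT n : measurable_fun [set: T * n.-tuple T] (@consT n).
Proof. exact: measurable_cons. Qed.

HB.instance Definition _ n :=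
  @isMeasurableFun.Build _ _ (T * n.-tuple T)%type (n.+1.-tuple T)
    (@consT n) (@measurable_consT n).

(* [n.-tuple T] carries the product sigma-algebra; the product of [n] copies of
   [P] is transported from [T * n.-tuple T] at each step, starting from the
   unique probability on the one-point space [0.-tuple T]. *)
Fixpoint product_power (P : probability T R) n : probability (n.-tuple T) R :=
  match n with
  | 0 => dirac ([tuple] : 0.-tuple T)
  | m.+1 => distribution (P \x product_power P m) (@consT m)
  end.

Lemma product_power_box (P : probability T R) n (A : 'I_n -> set T) :
  (forall i, measurable (A i)) ->
  product_power P n [set t | forall i, A i (tnth t i)] = \prod_(i < n) P (A i).
Proof.
elim: n A => [|n IHn] A mA.
  rewrite big_ord0 /= diracE mem_set//=.
  by case.
rewrite big_ord_recl -IHn//= /distribution /pushforward.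
rewrite [X in product_measure1 _ _ X](_ : _ =
    A ord0 `*` [set t | forall i, A (lift ord0 i) (tnth t i)]).
  rewrite product_measure1E//.
  rewrite (_ : [set _ | _] = \bigcap_(i in [set: 'I_n])
    (@tnth n T ^~ i @^-1` A (lift ord0 i))).
    apply: fin_bigcap_measurable => [|i _]; first exact: finite_finset.
    rewrite -[X in measurable X]setTI.
    exact: measurable_tnth.
  by apply/seteqP; split => t /= h i; [move=> _|]; exact: h.
apply/seteqP; split => -[x t] /=.
  move=> h; split; first exact: (h ord0).
  by move=> i; move: (h (lift ord0 i)); rewrite /consT tnthS.
move=> [h0 h] i; have [->//|] := eqVneq i ord0.
by case: (unliftP ord0 i) => [j ->|->//] _; rewrite /consT tnthS; exact: h.
Qed.

End product_power.

Section fortet_mourier.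
Context (R : realType).

Definition fm_class (p : R) : set (R -> R) :=
  [set g | forall x y : R,
    (`|g x - g y| <= (Num.max 1 (Num.max `|x| `|y|)) `^ (p - 1) * `|x - y|)%R].

(* The arguments are set functions so that push-forwards can be used without
   bundling a proof that the pushed map is measurable. *)
Definition fortet_mourier (p : R) (mu nu : set (measurableTypeR R) -> \bar R)
    : \bar R :=
  ereal_sup [set `| \int[mu]_x (g x)%:E - \int[nu]_x (g x)%:E |
            | g in fm_class p].

Definition kantorovich (mu nu : set (measurableTypeR R) -> \bar R) : \bar R :=
  fortet_mourier 1 mu nu.

Definition moment_class (phi : R -> R) : set (probability (measurableTypeR R) R) :=
  [set P | \int[P]_x (phi x)%:E < +oo].

End fortet_mourier.

Section robust_estimator.
Context (R : realType).

(* The greatest element of [A] ([0] by convention if there is none). *)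
Definition greatest (A : set R) : R := xget 0%R (A `&` ubound A).

Definition estimator (X : set R) (U : set (R -> R)) (N : nat)
    (xi : N.-tuple (measurableTypeR R)) : measurableTypeR R :=
  greatest [set inf [set (N%:R^-1 *
                          \sum_(k < N) (u x + u ((tnth xi k : R) - x)))%R
                    | u in U]
           | x in X].

Definition utility_envelope (U : set (R -> R)) (t : R) : \bar R :=
  ereal_sup [set `|u t|%:E | u in U].

(* An extended-real-valued [f] is a gauge function when it is in fact
   real-valued, hence the existential over [psi : R -> R]. *)
Definition gauge_function (f : R -> \bar R) : Prop :=
  exists psi : R -> R,
    [/\ forall t, f t = (psi t)%:E,
        forall t, (0 <= psi t)%R,
        continuous psi &
        exists2 K : set R, compact K & forall t, ~ K t -> (1 <= psi t)%R].

End robust_estimator.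

(* Main.v *)
Require Import Defs.
From mathcomp Require Import all_boot all_order all_algebra.
From mathcomp Require Import all_classical all_reals all_analysis.
From mathcomp Require Import measurable_realfun lra.

Import Order.TTheory GRing.Theory Num.Theory.
Import numFieldNormedType.Exports.

Local Open Scope classical_set_scope.
Local Open Scope ring_scope.

(** Why the bound holds.

    Let w(x, y) = max(1, |x|, |y|)^(p-1) |x - y| be the modulus that defines the
    Fortet-Mourier class of order p.  The argument has two independent halves.

    - The estimator is a max of infima of averages, and both max and inf are
      nonexpansive for the uniform distance.  The growth assumption on the
      utilities therefore passes to the estimator: it is Lipschitz with constant
      L/N for the cost sum_k w(s_k, t_k) between samples
      ([estimator_cost_lipschitz]).  Nonexpansiveness of the max requires that
      it be attained, which follows from compactness of X, because all
      utilities share a Lipschitz constant on each bounded set, so that their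
      infimum is continuous.

    - If h is c-Lipschitz for the sum cost on samples of size n, then its means
      under the n-th powers of P and Q differ by at most n c d(P, Q), where d is
      the Fortet-Mourier distance ([product_power_fortet_mourier]).  One
      replaces P by Q one coordinate at a time: integrating out the first
      coordinate of h against Q leaves a function that is again c-Lipschitz for
      the sum cost, while exchanging P and Q in that coordinate costs c d(P, Q),
      since h/c is in the Fortet-Mourier class as a function of this coordinate.

    Composing the estimator with a 1-Lipschitz test function keeps the constant
    c = L/N, so the Kantorovich distance of the two laws is at most
    N (L/N) d(P, Q) = L d(P, Q).  What remains is measurability and
    integrability.  A function on samples that is continuous in the product
    sense is measurable, because open sets of tuples are countable unions of
    rational boxes ([tuple_continuous_measurable]); integrability is proved by
    the same induction on the sample size, through Tonelli, from the single fact
    that w(., 0) is integrable, and w(x, 0) <= |x| + |x|^p. *)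

(** * The Fortet-Mourier modulus *)

Section cost.
Context {R : realType}.
Implicit Types (p c x y : R) (f : R -> R).

Definition fm_cost p x y : R :=
  (Num.max 1 (Num.max `|x| `|y|)) `^ (p - 1) * `|x - y|.

Lemma fm_cost_ge0 p x y : 0 <= fm_cost p x y.
Proof. by rewrite mulr_ge0// powR_ge0. Qed.

Lemma fm_costxx p x : fm_cost p x x = 0.
Proof. by rewrite /fm_cost subrr normr0 mulr0. Qed.

Lemma fm_cost_local p M x y : 1 <= p -> 1 <= M -> `|x| <= M -> `|y| <= M ->
  fm_cost p x y <= M `^ (p - 1) * `|x - y|.
Proof.
move=> p1 M1 xM yM; apply: ler_wpM2r => //.
apply: ge0_ler_powR; rewrite ?subr_ge0 ?nnegrE ?le_max ?ler01 ?ge_max ?M1 ?xM//.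
exact: le_trans M1.
Qed.

(** This is how the moment condition enters: the two summands bound the cost
    for |x| <= 1 and for |x| > 1 respectively. *)
Lemma fm_cost0_le p x : 1 <= p -> fm_cost p x 0 <= `|x| + `|x| `^ p.
Proof.
move=> p1; rewrite /fm_cost subr0 normr0 (max_l (normr_ge0 x)).
have [x1|x1] := leP `|x| 1.
  by rewrite powR1 mul1r lerDl powR_ge0.
by rewrite mulrC mulr_powRB1 ?lerDr// (lt_le_trans ltr01).
Qed.

(** Lipschitz constants that hold on balls around the origin are all that the
    growth condition provides, and the form in which it is used. *)
Lemma locally_lipschitz_continuous f :
  (forall M, exists K, forall x y, `|x| <= M -> `|y| <= M ->
     `|f x - f y| <= K * `|x - y|) -> continuous f.
Proof.
move=> fK x; have [K fxK] := fK (`|x| + 1).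
apply/cvgrPdist_lt => e e0.
pose d : R := Num.min 1 (e / (`|K| + 1)).
have K1 : 0 < `|K| + 1 by rewrite ltr_wpDl.
have d0 : 0 < d by rewrite lt_min ltr01 divr_gt0.
near=> y.
have : `|x - y| < d by near: y; exact: cvgr_dist_lt.
rewrite lt_min => /andP[xy1 xye].
apply: (@le_lt_trans _ _ (`|K| * `|x - y|)).
  rewrite (le_trans (fxK _ _ _ _))//.
  - by rewrite lerDl.
  - have -> : y = x - (x - y) by rewrite opprB addrC subrK.
    by rewrite (le_trans (ler_normB _ _))// lerD2l ltW.
  - by rewrite ler_wpM2r// ler_norm.
rewrite (@le_lt_trans _ _ ((`|K| + 1) * `|x - y|))//.
  by rewrite ler_wpM2r// lerDl.
by rewrite mulrC -ltr_pdivlMr.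
Unshelve. all: by end_near. Qed.

Lemma cost_lipschitz_continuous p c f : 1 <= p -> 0 <= c ->
  (forall x y, `|f x - f y| <= c * fm_cost p x y) -> continuous f.
Proof.
move=> p1 c0 fc; apply: locally_lipschitz_continuous => M.
exists (c * (Num.max 1 M) `^ (p - 1)) => x y xM yM.
rewrite (le_trans (fc x y))// -mulrA ler_wpM2l// fm_cost_local//.
- by rewrite le_max lexx.
- by rewrite le_max xM orbT.
- by rewrite le_max yM orbT.
Qed.

End cost.

(** * Measurability on spaces of tuples *)

Section tuple_measurability.
Context {R : realType}.

(** The product sigma-algebra on tuples is generated by the coordinates, and
    continuity is spelled out coordinatewise to match.  The preimage of an open
    ray is the union of the rational cubes that it contains, of which there are
    countably many. *)
Lemma tuple_continuous_measurable n (h : n.-tuple (measurableTypeR R) -> R) :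
  (forall t e, 0 < e -> exists2 d, 0 < d &
     forall s, (forall i, `|tnth s i - tnth t i| < d) -> `|h s - h t| < e) ->
  measurable_fun [set: n.-tuple (measurableTypeR R)] h.
Proof.
move=> hc; apply: (measurability _ (RGenOInfty.measurableE R)).
move=> _ [_ [a ->] <-]; rewrite setTI.
pose box (z : n.-tuple rat * rat) :=
  [set t : n.-tuple (measurableTypeR R) |
   forall i, `|tnth t i - ratr (tnth z.1 i)| < ratr z.2].
pose good z := `[< box z `<=` h @^-1` `]a, +oo[ >].
rewrite (_ : _ @^-1` _ = \bigcup_z (if good z then box z else set0)); last first.
  apply/seteqP; split => [t /=|t [z _]]; last by case: ifPn => // /asboolP; exact.
  rewrite in_itv/= andbT => aht.
  have [d d0 htd] := hc t (h t - a) ltac:(by rewrite subr_gt0).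
  (* A cube of half-side r that contains t, around a nearby rational centre,
     lies within 2r of t: hence r < d / 2. *)
  have [r /itvP rd] := @rat_in_itvoo R 0 (d / 2) ltac:(by rewrite divr_gt0).
  have r0 : 0 < (ratr r : R) by rewrite rd.
  have q_ (i : 'I_n) : exists q : rat, `|(tnth t i : R) - ratr q| < ratr r.
    have [q /itvP qr] := @rat_in_itvoo R (tnth t i - ratr r) (tnth t i + ratr r)
      ltac:(by rewrite ltrD2l gtrN).
    exists q; rewrite ltr_distl; apply/andP; split.
      by rewrite ltrBlDr qr.
    by rewrite -ltrBlDr qr.
  have [q tq] := choice q_.
  pose z := ([tuple q i | i < n], r).
  have tz : box z t by move=> i; rewrite tnth_mktuple; exact: tq.
  exists z => //; case: ifPn => // /asboolP; case => s sz /=.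
  rewrite in_itv/= andbT.
  have /htd : forall i, `|(tnth s i : R) - tnth t i| < d.
    move=> i; have := sz i; have := tz i; rewrite /= tnth_mktuple.
    have : ratr r < d / 2 by rewrite rd.
    move: (ratr (q i) : R) (ratr r : R) => u v.
    rewrite !ltr_distl => ? /andP[? ?] /andP[? ?].
    by apply/andP; split; lra.
  by rewrite ltr_distl => /andP[]; lra.
apply: countable_bigcupT_measurable => // z.
case: ifPn => // _.
rewrite (_ : box z = \bigcap_(i in [set: 'I_n])
    ((fun t : n.-tuple (measurableTypeR R) => tnth t i) @^-1`
     ball (ratr (tnth z.1 i) : R) (ratr z.2))); last first.
  apply/seteqP; split => t /= tz i; [move=> _|];
    by have := tz i; rewrite /= -ball_normE/= distrC//; exact.
apply: fin_bigcap_measurable => [|i _]; first exact: finite_finset.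
rewrite -[X in measurable X]setTI.
apply: (@measurable_tnth _ (measurableTypeR R) n i) => //.
apply: open_measurable; exact: ball_open.
Qed.

End tuple_measurability.

(** * Functions that are Lipschitz for the sum cost *)

Section probability_integrals.
Context {R : realType} {d : measure_display} {T : measurableType d}.
Variable P : probability T R.
Implicit Types f g : T -> R.

Lemma Rintegral_dist_le (K : R) f g :
  P.-integrable setT (EFin \o f) -> P.-integrable setT (EFin \o g) ->
  (forall x, `|f x - g x| <= K) ->
  `|\int[P]_x f x - \int[P]_x g x| <= K.
Proof.
move=> If Ig fgK; rewrite -RintegralB//.
have Ifg : P.-integrable setT (EFin \o (f \- g)).
  by have := integrableB measurableT If Ig.
have Ic := finite_measure_integrable_cst P K (@measurableT _ T).
have mfg := measurable_int _ Ifg.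
rewrite -lee_fin; apply: (@le_trans _ _ `|\int[P]_x (f x - g x)%:E|%E).
  by rewrite -[X in (X <= _)%E]/(`|(fine _)%:E|)%E fineK// (integrable_fin_num _ Ifg).
apply: (le_trans (le_abse_integral _ _ mfg)) => //.
apply: (@le_trans _ _ (\int[P]_x (cst K%:E x))%E).
  apply: ge0_le_integral => //= [|x _]; last by rewrite lee_fin.
  by apply/measurable_EFinP/measurableT_comp => //; exact/measurable_EFinP.
by rewrite integral_cst//= probability_setT mule1.
Qed.

End probability_integrals.

Section cost_lipschitz.
Context {R : realType}.
Local Notation T := (measurableTypeR R).
Variable p : R.
Hypothesis p1 : 1 <= p.
Implicit Types (c : R) (P Q : probability T R) (n : nat).

(** Samples are compared by the sum over coordinates of the modulus; the first
    coordinate can then be split off additively, which drives every induction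
    on the sample size below. *)
Definition cost_lipschitz c n (h : n.-tuple T -> R) :=
  forall s t, `|h s - h t| <= c * \sum_(i < n) fm_cost p (tnth s i) (tnth t i).

(** The multiples of w(., 0) dominate, up to a constant, all functions that are
    Lipschitz for the modulus; integrability of w(., 0) is thus the moment
    condition freed of L and C0. *)
Definition finite_moment P :=
  P.-integrable setT (fun x : T => (fm_cost p x 0)%:E).

Lemma cost_lipschitz_measurable c n (h : n.-tuple T -> R) :
  0 <= c -> cost_lipschitz c n h -> measurable_fun setT h.
Proof.
move=> c0 hc; apply: tuple_continuous_measurable => t e e0.
(* M bounds every coordinate of a tuple within distance 1 of t, so each cost is
   at most K times the coordinate distance. *)
pose M := 1 + \sum_(i < n) `|(tnth t i : R)|.
pose K := M `^ (p - 1).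
have S0 : 0 <= \sum_(i < n) `|(tnth t i : R)| by exact: sumr_ge0.
have tM i : `|(tnth t i : R)| + 1 <= M.
  by rewrite /M addrC lerD2l (bigD1 i)//= lerDl sumr_ge0.
have K0 : 0 <= K by exact: powR_ge0.
have B0 : 0 < c * (n%:R * K) + 1 by rewrite ltr_wpDl// !mulr_ge0.
exists (Num.min 1 (e / (c * (n%:R * K) + 1))) => [|s st].
  by rewrite lt_min ltr01 divr_gt0.
rewrite (le_lt_trans (hc s t))//.
set r := Num.min _ _ in st.
have r0 : 0 < r by rewrite lt_min ltr01 divr_gt0.
apply: (@le_lt_trans _ _ (c * (n%:R * K) * r)).
  rewrite -mulrA ler_wpM2l// -mulrA mulr_natl -[n in _ *+ n]card_ord -sumr_const.
  apply: ler_sum => i _.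
  rewrite (le_trans (@fm_cost_local _ p M _ _ _ _ _ _))//.
  - by rewrite lerDl.
  - have -> : (tnth s i : R) = tnth t i + (tnth s i - tnth t i) by rewrite addrC subrK.
    rewrite (le_trans (ler_normD _ _))// (le_trans _ (tM i))// lerD2l.
    by rewrite (le_trans (ltW (st i)))// ge_min lexx.
  - by rewrite (le_trans _ (tM i))// lerDl.
  - by rewrite ler_wpM2l// ltW.
apply: (@lt_le_trans _ _ ((c * (n%:R * K) + 1) * r)).
  by rewrite ltr_pM2r// ltrDl.
by rewrite mulrC -ler_pdivlMr// ge_min lexx orbT.
Qed.

(** A cost-Lipschitz f is dominated by |f 0| + c w(x, 0). *)
Lemma cost_lipschitz_integrable1 c P (f : T -> R) : 0 <= c -> finite_moment P ->
  (forall x y, `|f x - f y| <= c * fm_cost p x y) ->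
  P.-integrable setT (EFin \o f).
Proof.
move=> c0 Pp fc.
have mf : measurable_fun setT (EFin \o f).
  apply/measurable_EFinP; apply: continuous_measurable_fun.
  exact: (cost_lipschitz_continuous p c).
have Ic := finite_measure_integrable_cst P (`|f 0| : R) (@measurableT _ T).
have := integrableD measurableT Ic (integrableZl measurableT c Pp).
apply: le_integrable => // x _ /=.
rewrite lee_fin [leRHS]ger0_norm; last first.
  by rewrite addr_ge0// mulr_ge0// fm_cost_ge0.
rewrite -lerBlDl (le_trans _ (fc x 0))//.
by rewrite (le_trans (lerB_dist _ _)).
Qed.

Lemma cost_lipschitz_cons c n (h : n.+1.-tuple T -> R) x y s t :
  cost_lipschitz c n.+1 h ->
  `|h (consT (x, s)) - h (consT (y, t))| <=
  c * (fm_cost p x y + \sum_(i < n) fm_cost p (tnth s i) (tnth t i)).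
Proof.
move=> hc; rewrite (le_trans (hc _ _))// big_ord_recl !tnth0.
by under eq_bigr do rewrite !tnthS.
Qed.

Lemma cost_lipschitz_consl c n (h : n.+1.-tuple T -> R) t :
  cost_lipschitz c n.+1 h -> forall x y,
  `|h (consT (x, t)) - h (consT (y, t))| <= c * fm_cost p x y.
Proof.
move=> hc x y; rewrite (le_trans (cost_lipschitz_cons c n h x y t t hc))//.
by rewrite big1 ?addr0// => i _; rewrite fm_costxx.
Qed.

(** Averaging over one coordinate preserves the constant, since P has total
    mass one; this closes the inductions under integrating out. *)
Lemma cost_lipschitz_Rintegral c n P (h : n.+1.-tuple T -> R) :
  0 <= c -> finite_moment P -> cost_lipschitz c n.+1 h ->
  cost_lipschitz c n (fun t => \int[P]_x h (consT (x, t))).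
Proof.
move=> c0 Pp hc s t.
have Ih u : P.-integrable setT (EFin \o (fun x : T => h (consT (x, u)))).
  exact: (cost_lipschitz_integrable1 c P _ c0 Pp (cost_lipschitz_consl c n h u hc)).
apply: Rintegral_dist_le => // x.
by rewrite (le_trans (cost_lipschitz_cons c n h x x s t hc))// fm_costxx add0r.
Qed.

Lemma cost_lipschitz_norm c n (h : n.-tuple T -> R) :
  cost_lipschitz c n h -> cost_lipschitz c n (fun t => `|h t|).
Proof. by move=> hc s t; rewrite (le_trans (ler_dist_dist _ _))// hc. Qed.

Lemma measurable_comp_consT c n (h : n.+1.-tuple T -> R) :
  0 <= c -> cost_lipschitz c n.+1 h ->
  measurable_fun setT (EFin \o (h \o @consT _ T n)).
Proof.
move=> c0 hc; apply/measurable_EFinP; apply: measurableT_comp.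
  exact: (cost_lipschitz_measurable c).
exact: measurable_consT.
Qed.

(** By Tonelli it suffices that the mean of |h| over the first coordinate is
    integrable in the others; that mean is cost-Lipschitz because |h| is, so it
    is covered by the hypothesis on smaller samples. *)
Lemma cost_lipschitz_integrable_consT c P n (h : n.+1.-tuple T -> R) :
  (forall k : n.-tuple T -> R, cost_lipschitz c n k ->
    (product_power P n).-integrable setT (EFin \o k)) ->
  0 <= c -> finite_moment P -> cost_lipschitz c n.+1 h ->
  (P \x product_power P n)%E.-integrable setT (EFin \o (h \o @consT _ T n)).
Proof.
move=> IH c0 Pp hc; apply/integrable21ltyP; first exact: measurable_comp_consT hc.
have hc' := cost_lipschitz_norm c n.+1 h hc.
have := IH _ (cost_lipschitz_Rintegral c n P _ c0 Pp hc').
move=> /(integrable_lty measurableT); congr (_ < _)%E.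
apply: eq_integral => t _ /=; rewrite fineK//.
apply: (integrable_fin_num measurableT).
exact: (cost_lipschitz_integrable1 c P _ c0 Pp (cost_lipschitz_consl c n _ t hc')).
Qed.

Lemma cost_lipschitz_integrable c P n (h : n.-tuple T -> R) :
  0 <= c -> finite_moment P -> cost_lipschitz c n h ->
  (product_power P n).-integrable setT (EFin \o h).
Proof.
move=> c0 Pp; elim: n => [|n IH] in h *.
  move=> hc; apply: (@le_integrable _ _ _ _ _ measurableT _
      (EFin \o cst (h [tuple]))).
  - apply/measurable_EFinP; exact: cost_lipschitz_measurable hc.
  - by move=> t _; rewrite tuple0.
  - exact: finite_measure_integrable_cst.
move=> hc; apply: (integrable_pushforward (@measurable_consT _ T n)) => //.
- by apply/measurable_EFinP; exact: cost_lipschitz_measurable hc.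
- exact: cost_lipschitz_integrable_consT hc.
Qed.

Lemma Rintegral_product_powerS c P n (h : n.+1.-tuple T -> R) :
  0 <= c -> finite_moment P -> cost_lipschitz c n.+1 h ->
  \int[product_power P n.+1]_t h t =
  \int[product_power P n]_t \int[P]_x h (consT (x, t)).
Proof.
move=> c0 Pp hc.
have Ih : (P \x product_power P n)%E.-integrable setT (EFin \o (h \o @consT _ T n)).
  apply: (cost_lipschitz_integrable_consT c) => // k.
  exact: cost_lipschitz_integrable.
rewrite /Rintegral integral_distribution//; last first.
  by apply/measurable_EFinP; exact: cost_lipschitz_measurable hc.
rewrite -integral21_prod_meas1//; congr fine.
apply: eq_integral => t _ /=; rewrite fineK//.
apply: (integrable_fin_num measurableT).
exact: (cost_lipschitz_integrable1 c P _ c0 Pp (cost_lipschitz_consl c n h t hc)).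
Qed.

Lemma fortet_mourier_ge P Q (f : R -> R) : fm_class p f ->
  (`|\int[P]_x (f x)%:E - \int[Q]_x (f x)%:E| <= fortet_mourier p P Q)%E.
Proof. by move=> fp; apply: ereal_sup_ubound; exists f. Qed.

(** The rescaled function f / c is a test function for the distance. *)
Lemma Rintegral_fortet_mourier_le c P Q (f : T -> R) :
  0 < c -> finite_moment P -> finite_moment Q ->
  fortet_mourier p P Q \is a fin_num ->
  (forall x y, `|f x - f y| <= c * fm_cost p x y) ->
  `|\int[P]_x f x - \int[Q]_x f x| <= c * fine (fortet_mourier p P Q).
Proof.
move=> c0 Pp Qp Dfin fc.
have gp : fm_class p (fun x => c^-1 * f x).
  move=> x y; rewrite -mulrBr normrM gtr0_norm ?invr_gt0//.
  by rewrite ler_pdivrMl// fc.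
have If P' : finite_moment P' -> P'.-integrable setT (EFin \o f).
  by move=> P'p; exact: (cost_lipschitz_integrable1 c P' f (ltW c0) P'p fc).
have Ig P' : finite_moment P' ->
    (\int[P']_x (c^-1 * f x)%:E = (c^-1 * \int[P']_x f x)%:E)%E.
  move=> P'p; rewrite -RintegralZl//; last exact: If.
  rewrite fineK//; apply: (integrable_fin_num measurableT).
  by have := integrableZl measurableT c^-1 (If _ P'p).
have := fortet_mourier_ge P Q _ gp.
rewrite !Ig// -EFinB abse_EFin -[X in (_ <= X)%E]fineK// lee_fin -mulrBr.
by rewrite normrM gtr0_norm ?invr_gt0// ler_pdivrMl.
Qed.

(** Coordinates are exchanged one at a time.  The intermediate quantity draws the
    first coordinate from Q and the others from P: its distance to the P-mean is
    a one-coordinate comparison, averaged over the others, and its distance to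
    the Q-mean is the inductive hypothesis for h averaged over Q. *)
Lemma product_power_fortet_mourier c P Q n (h : n.-tuple T -> R) :
  0 < c -> finite_moment P -> finite_moment Q ->
  fortet_mourier p P Q \is a fin_num -> cost_lipschitz c n h ->
  `|\int[product_power P n]_t h t - \int[product_power Q n]_t h t| <=
  n%:R * (c * fine (fortet_mourier p P Q)).
Proof.
move=> c0 Pp Qp Dfin; have c0' := ltW c0.
elim: n => [|n IH] in h *; first by rewrite subrr normr0 mul0r.
move=> hc.
rewrite (Rintegral_product_powerS c P)// (Rintegral_product_powerS c Q)//.
have hQ := cost_lipschitz_Rintegral c n Q h c0' Qp hc.
have hP := cost_lipschitz_Rintegral c n P h c0' Pp hc.
pose mid := \int[product_power P n]_t \int[Q]_x h (consT (x, t)).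
rewrite (le_trans (ler_distD mid _ _))//.
rewrite -natr1 mulrDl mul1r [leRHS]addrC lerD//; last exact: IH.
apply: Rintegral_dist_le => [||t].
- exact: cost_lipschitz_integrable hP.
- exact: cost_lipschitz_integrable hQ.
- apply: Rintegral_fortet_mourier_le => //; exact: cost_lipschitz_consl.
Qed.

End cost_lipschitz.

(** * Infima and maxima are nonexpansive *)

Section nonexpansive.
Context {R : realType}.

Lemma inf_image_dist_le {I : Type} (A : set I) (f g : I -> R) (K : R) :
  A !=set0 -> has_lbound (f @` A) -> has_lbound (g @` A) ->
  (forall i, A i -> `|f i - g i| <= K) ->
  `|inf (f @` A) - inf (g @` A)| <= K.
Proof.
move=> A0.
have half u v : has_lbound (u @` A) -> (forall i, A i -> `|u i - v i| <= K) ->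
    inf (u @` A) - K <= inf (v @` A).
  move=> lu uv; apply: lb_le_inf; first exact: image_nonempty.
  move=> _ [i Ai <-].
  have := @ge_inf _ _ lu _ (imageP u Ai); have := uv _ Ai.
  by rewrite ler_distl => /andP[]; lra.
move=> lf lg fg.
have gf i : A i -> `|g i - f i| <= K by move=> Ai; rewrite distrC fg.
by rewrite ler_distl; have := half _ _ lf fg; have := half _ _ lg gf; lra.
Qed.

(** Compactness rules out the default value of [greatest], which would break the
    Lipschitz bound. *)
Lemma greatest_image {T : topologicalType} (A : set T) (f : T -> R) :
  A !=set0 -> compact A -> {within A, continuous f} ->
  (f @` A `&` ubound (f @` A)) (greatest (f @` A)).
Proof.
move=> A0 cA cf; have [c cAin fmax] := compact_EVT_max A0 cA cf.
apply: xgetPex; exists (f c); split; first exact/imageP/set_mem.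
by move=> _ [x Ax <-]; exact/fmax/mem_set.
Qed.

Lemma greatest_image_dist_le {T : topologicalType} (A : set T) (f g : T -> R)
    (K : R) :
  A !=set0 -> compact A -> {within A, continuous f} ->
  {within A, continuous g} -> (forall x, A x -> `|f x - g x| <= K) ->
  `|greatest (f @` A) - greatest (g @` A)| <= K.
Proof.
move=> A0 cA cf cg fg.
have [[x Ax <-] fx] := greatest_image A f A0 cA cf.
have [[y Ay <-] gy] := greatest_image A g A0 cA cg.
have := fx _ (imageP f Ay); have := gy _ (imageP g Ax).
have := fg _ Ax; have := fg _ Ay; rewrite !ler_distl.
by move=> /andP[? ?] /andP[? ?] ? ?; apply/andP; split; lra.
Qed.

End nonexpansive.

(** * Regularity of the estimator *)

Section estimator_regularity.
Context {R : realType}.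
Local Notation T := (measurableTypeR R).
Variables (p L : R) (X : set R) (U : set (R -> R)).
Hypotheses (p1 : 1 <= p) (L0 : 0 < L) (X_compact : compact X).
Hypotheses (X0 : X !=set0) (U0 : U !=set0).
Hypothesis U_growth : forall x u, X x -> U u -> forall s t : R,
  `|u (s - x) - u (t - x)| <= L * fm_cost p s t.
Variable psi : R -> R.
Hypothesis U_bounded : forall u t, U u -> `|u t| <= psi t.

Definition sample_utility N (xi : N.-tuple T) (x : R) (u : R -> R) : R :=
  N%:R^-1 * \sum_(k < N) (u x + u ((tnth xi k : R) - x)).

Lemma sample_utility_lbound N (xi : N.-tuple T) x :
  has_lbound (sample_utility N xi x @` U).
Proof.
exists (N%:R^-1 * \sum_(k < N) (- psi x - psi ((tnth xi k : R) - x))).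
move=> _ [u Uu <-]; rewrite ler_wpM2l// ler_sum// => k _.
have := U_bounded u x Uu; have := U_bounded u ((tnth xi k : R) - x) Uu.
by rewrite !ler_norml => /andP[? ?] /andP[? ?]; lra.
Qed.

Lemma sample_utility_dist_le N (xi xi' : N.-tuple T) x u : X x -> U u ->
  `|sample_utility N xi x u - sample_utility N xi' x u| <=
  N%:R^-1 * L * \sum_(k < N) fm_cost p (tnth xi k) (tnth xi' k).
Proof.
move=> Xx Uu; rewrite -mulrBr normrM ger0_norm// -mulrA ler_wpM2l//.
rewrite -sumrB (le_trans (ler_norm_sum _ _ _))// mulr_sumr ler_sum// => k _.
by rewrite opprD addrACA subrr add0r U_growth.
Qed.

(** The growth condition only concerns shifts by points of X; shifting back by
    one fixed point z of X gives a bound for the utilities themselves. *)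
Lemma utility_equilipschitz (M : R) : exists2 K, 0 <= K &
  forall u, U u -> forall s t, `|s| <= M -> `|t| <= M ->
  `|u s - u t| <= K * `|s - t|.
Proof.
have [z Xz] := X0.
pose B := Num.max 1 (M + `|z|).
exists (L * B `^ (p - 1)) => [|u Uu s t sM tM].
  by rewrite mulr_ge0 ?powR_ge0 ?ltW.
have := U_growth z u Xz Uu (s + z) (t + z); rewrite !addrK => /le_trans; apply.
rewrite -mulrA ler_wpM2l ?(ltW L0)//.
have shift (r : R) : `|r| <= M -> `|r + z| <= B.
  move=> rM; rewrite le_max; apply/orP; right.
  by rewrite (le_trans (ler_normD _ _))// lerD2r.
have -> : `|s - t| = `|(s + z) - (t + z)| by rewrite opprD addrACA subrr addr0.
by apply: fm_cost_local => //; rewrite ?shift// le_max lexx.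
Qed.

Lemma inf_sample_utility_continuous N (xi : N.-tuple T) : (0 < N)%N ->
  continuous (fun x => inf (sample_utility N xi x @` U)).
Proof.
move=> N0; apply: locally_lipschitz_continuous => M.
(* B bounds both x and every shifted observation xi_k - x when |x| <= M; each of
   the two utility terms then contributes K |x - y|. *)
pose B := M + \sum_(k < N) `|(tnth xi k : R)|.
have [K K0 uK] := utility_equilipschitz B.
exists (K + K) => x y xM yM.
apply: inf_image_dist_le => // [||u Uu]; try exact: sample_utility_lbound.
rewrite -mulrBr normrM ger0_norm// ler_pdivrMl ?ltr0n//.
rewrite -sumrB (le_trans (ler_norm_sum _ _ _))//.
rewrite -[in N%:R](card_ord N) mulr_natl -sumr_const ler_sum// => k _.
have S0 (P : pred 'I_N) : 0 <= \sum_(i < N | P i) `|(tnth xi i : R)|.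
  exact: sumr_ge0.
have inB (r : R) : `|r| <= M -> `|r| <= B /\ `|(tnth xi k : R) - r| <= B.
  move=> rM; rewrite /B; split; first by rewrite (le_trans rM)// lerDl S0.
  rewrite (le_trans (ler_normB _ _))// addrC lerD// (bigD1 k)//= lerDl.
  exact: S0.
have [xB xkB] := inB x xM; have [yB ykB] := inB y yM.
rewrite opprD addrACA (le_trans (ler_normD _ _))// mulrDl lerD ?uK//.
rewrite (le_trans (uK _ Uu _ _ xkB ykB))// opprB addrC addrA subrK.
by rewrite distrC.
Qed.

Lemma estimator_cost_lipschitz N : (0 < N)%N ->
  cost_lipschitz p (N%:R^-1 * L) N (estimator X U (N := N)).
Proof.
move=> N0 xi xi'; apply: greatest_image_dist_le => //.
- exact/continuous_subspaceT/inf_sample_utility_continuous.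
- exact/continuous_subspaceT/inf_sample_utility_continuous.
- move=> x Xx; apply: inf_image_dist_le => // [||u Uu].
  + exact: sample_utility_lbound.
  + exact: sample_utility_lbound.
  + exact: sample_utility_dist_le.
Qed.

End estimator_regularity.

(** Without decisions or without utilities the conventions for [greatest] and
    [inf] of the empty set make the estimator constant. *)
Lemma estimator_degenerate {R : realType} (X : set R) (U : set (R -> R)) N
    (xi : N.-tuple (measurableTypeR R)) :
  ~ (X !=set0 /\ U !=set0) -> estimator X U xi = 0.
Proof.
move=> XU; rewrite /estimator /greatest.
have [->|/set0P X0] := eqVneq X set0.
  by rewrite image_set0 xgetPN// => x [[]].
have [->|/set0P U0] := eqVneq U set0; last by case: XU.
case: xgetP => [y _ [[x _ <-] _]|//].
by rewrite image_set0 inf0.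
Qed.

(** The integrand in the moment condition dominates L w(x, 0). *)
Lemma moment_class_finite_moment {R : realType} (p L C : R)
    (P : probability (measurableTypeR R) R) :
  1 <= p -> 0 < L -> 0 <= C ->
  moment_class (fun x => C + L * (`|x| + `|x| `^ p)) P -> finite_moment p P.
Proof.
move=> p1 L0 C0 Pphi.
have mphi : measurable_fun [set: measurableTypeR R]
    (fun x : R => (C + L * (`|x| + `|x| `^ p))%:E).
  apply/measurable_EFinP; apply: measurable_funD => //.
  apply: measurable_funM => //; apply: measurable_funD => //.
  by apply: (measurableT_comp (measurable_powR p)).
have phi0 (x : R) : 0 <= C + L * (`|x| + `|x| `^ p).
  by rewrite addr_ge0// mulr_ge0 ?(ltW L0)// addr_ge0// powR_ge0.
(* The moment condition integrates over the real line with its own Borel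
   structure, while P lives on the isomorphic [measurableTypeR R]; the integral
   is transported along the identity. *)
have mid : measurable_fun [set: measurableTypeR R] (id : measurableTypeR R -> R).
  exact: (@measurable_id _ _ setT).
have Iphi : P.-integrable setT
    (fun x : measurableTypeR R => (C + L * (`|x| + `|x| `^ p))%:E).
  apply/integrableP; split => //.
  under eq_integral do rewrite gee0_abs ?lee_fin//.
  have <- := @ge0_integral_pushforward _ _ _ _ _ _ mid P setT
    (fun x : R => (C + L * (`|x| + `|x| `^ p))%:E) measurableT mphi _.
    exact: Pphi.
  by move=> x _; rewrite lee_fin.
have := integrableZl measurableT L^-1 Iphi.
apply: le_integrable => //.
  apply/measurable_EFinP; apply: measurable_funM.
    apply: (measurableT_comp (measurable_powR (p - 1))).
    by do 2 apply: measurable_maxr => //.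
  apply: measurableT_comp => //; exact: measurable_funB.
move=> x _ /=; rewrite lee_fin ger0_norm ?fm_cost_ge0//.
apply: le_trans (ler_norm _).
rewrite ler_pdivlMl// (le_trans (ler_wpM2l (ltW L0) (fm_cost0_le p x p1)))//.
by rewrite lerDr.
Qed.

(** * Comparison of the laws of the estimator *)

Lemma fortet_mourier_ge0 {R : realType} (p : R)
    (P Q : probability (measurableTypeR R) R) : (0 <= fortet_mourier p P Q)%E.
Proof.
have g0 : fm_class p (cst 0 : R -> R).
  by move=> x y; rewrite subrr normr0 mulr_ge0// powR_ge0.
exact: (le_trans (abse_ge0 _) (fortet_mourier_ge p P Q _ g0)).
Qed.

(** Change of variables reduces the Kantorovich distance of two image laws to
    integrals of 1-Lipschitz functions of F over the original spaces. *)
Lemma kantorovich_pushforward_le {R : realType} d (T : measurableType d)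
    (mu nu : probability T R) (F : T -> measurableTypeR R) (K : \bar R) :
  measurable_fun setT F ->
  (forall g : R -> R, (forall x y, `|g x - g y| <= `|x - y|) ->
     [/\ mu.-integrable setT (EFin \o (g \o F)),
         nu.-integrable setT (EFin \o (g \o F)) &
         (`|\int[mu]_t g (F t) - \int[nu]_t g (F t)|%:E <= K)%E]) ->
  (kantorovich (pushforward mu F) (pushforward nu F) <= K)%E.
Proof.
move=> mF gK; apply: ub_ereal_sup => _ [g g1 <-].
have g1' x y : `|g x - g y| <= `|x - y|.
  by have := g1 x y; rewrite subrr powRr0 mul1r.
have [Imu Inu] := gK g g1'.
have mg : measurable_fun [set: measurableTypeR R] (EFin \o g).
  apply/measurable_EFinP; apply: continuous_measurable_fun.
  by apply: locally_lipschitz_continuous => M; exists 1 => x y _ _; rewrite mul1r.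
rewrite !integral_pushforward//.
apply: le_trans; rewrite -abse_EFin EFinB !fineK//;
  exact: (integrable_fin_num measurableT).
Qed.

Theorem theorem6p1 (R : realType) (p : R) (X : set R) (U : set (R -> R)) (L : R)
    (p_ge1 : 1 <= p)
    (X_compact : compact X)
    (U_nondecreasing : forall u, U u -> {homo u : s t / s <= t})
    (L_gt0 : 0 < L)
    (U_growth : forall x u, X x -> U u -> forall xi xi' : R,
       `|u (xi - x) - u (xi' - x)| <=
       L * (Num.max 1 (Num.max `|xi| `|xi'|)) `^ (p - 1) * `|xi - xi'|)
    (U_gauge : gauge_function (utility_envelope U)) :
  exists2 C0 : R, 1 < C0 &
    forall N : nat, (0 < N)%N ->
    forall P Q : probability (measurableTypeR R) R,
      moment_class (fun xi => C0 + L * (`|xi| + `|xi| `^ p)) P ->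
      moment_class (fun xi => C0 + L * (`|xi| + `|xi| `^ p)) Q ->
      (kantorovich
         (pushforward (product_power P N) (estimator X U (N := N)))
         (pushforward (product_power Q N) (estimator X U (N := N)))
       <= L%:E * fortet_mourier p P Q)%E.
Proof.
(* Constants are integrable against a probability, so any value above 1 serves. *)
exists 2 => [|N N0 P Q Pphi Qphi]; first by lra.
have Pp := moment_class_finite_moment p L 2 P p_ge1 L_gt0 (ler0n _ 2) Pphi.
have Qp := moment_class_finite_moment p L 2 Q p_ge1 L_gt0 (ler0n _ 2) Qphi.
have c0 : 0 < N%:R^-1 * L by rewrite mulr_gt0// invr_gt0 ltr0n.
have Flip : cost_lipschitz p (N%:R^-1 * L) N (estimator X U (N := N)).
  have [[X0 U0]|XU] := pselect (X !=set0 /\ U !=set0); last first.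
    move=> s t; rewrite !estimator_degenerate// subrr normr0.
    by rewrite mulr_ge0 ?(ltW c0)// sumr_ge0// => i _; exact: fm_cost_ge0.
  have [psi [Upsi _ _ _]] := U_gauge.
  apply: (@estimator_cost_lipschitz _ p L X U p_ge1 L_gt0 X_compact X0 U0 _ psi) => //.
  - by move=> x u Xx Uu s t; rewrite /fm_cost mulrA U_growth.
  - move=> u t Uu; rewrite -lee_fin -Upsi.
    by apply: ereal_sup_ubound; exists u.
apply: kantorovich_pushforward_le => [|g g1].
  exact: (cost_lipschitz_measurable p p_ge1 _ N _ (ltW c0) Flip).
have gFlip : cost_lipschitz p (N%:R^-1 * L) N (g \o estimator X U (N := N)).
  by move=> s t; rewrite (le_trans (g1 _ _)).
split; try exact: (cost_lipschitz_integrable p p_ge1 _ _ N _ (ltW c0) _ gFlip).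
(* At infinite distance the right-hand side is infinite because L > 0. *)
have [Dfin|] := boolP (fortet_mourier p P Q \is a fin_num); last first.
  by rewrite ge0_fin_numE ?fortet_mourier_ge0// ltey negbK => /eqP ->;
    rewrite gt0_muley ?lte_fin// leey.
rewrite -(fineK Dfin) -EFinM lee_fin.
have := product_power_fortet_mourier p p_ge1 _ P Q N _ c0 Pp Qp Dfin gFlip.
by rewrite mulrA mulrA divff ?mul1r// pnatr_eq0 -lt0n.
Qed.
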